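(* In the setting of the soft-label KNN classification utility, assume $N\ge\max(2,K)$ and let $K^*$ be an integer with $1\le K^*<N$. Write $a_i:=\mathbb 1[y_i=y_{\mathrm{test}}]$. Define $\widehat\phi\in\mathbb R^N$ by $\widehat\phi_i=\frac1N\big(\frac12-\frac1C\big)$ for $K^*\le i\le N$, and recursively for $i=K^*-1,K^*-2,\dots,1$, $$\widehat\phi_i=\widehat\phi_{i+1}+\frac{a_i-a_{i+1}}{N-1}\left[\sum_{j=1}^{K}\frac1j+\frac1K\Big(\frac{\min(i,K)(N-1)}{i}-K\Big)\right].$$ Then, with $\phi=(\phi_1,\dots,\phi_N)$ the Shapley values, $$\|\widehat\phi-\phi\|_\infty\le\frac1N\sum_{j=2}^{K-1}\frac1{j+1}+\frac{1}{\max(K^*,K)},$$ where the sum is empty (zero) when $K\le 2$.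
   Context: Training data $(x_i,y_i)$, $i\in\mathcal I=\{1,\dots,N\}$, with $x_i\in\mathbb R^d$ and labels in a set of $C\ge1$ classes; test point $(x_{\mathrm{test}},y_{\mathrm{test}})$; $K\ge 1$ an integer. Indices are sorted so that $\|x_1-x_{\mathrm{test}}\|\le\dots\le\|x_N-x_{\mathrm{test}}\|$ (Euclidean norm, ties broken by index). For nonempty $S\subseteq\mathcal I$, $\pi^{(S)}(j)$ is the $j$-th smallest index in $S$. The utility is $v(\emptyset)=\frac1C$ and, for $S\ne\emptyset$, $v(S)=\frac{1}{\min(K,|S|)}\sum_{j=1}^{\min(K,|S|)}\mathbb 1[y_{\pi^{(S)}(j)}=y_{\mathrm{test}}]$. The Shapley value of $i$ is $\phi_i=\frac1N\sum_{k=1}^{N}\binom{N-1}{k-1}^{-1}\sum_{S\subseteq\mathcal I\setminus\{i\},\,|S|=k-1}\big[v(S\cup\{i\})-v(S)\big]$. *)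

(* Defs.v *)
(* Indices: the paper's training index i in {1..N} is
   represented by the ordinal (i-1) : 'I_N; the ordinal order is the
   (already sorted) order by distance to the test point. *)
From mathcomp Require Import all_boot all_order all_algebra.
Set Implicit Arguments. Unset Strict Implicit. Unset Printing Implicit Defensive.
Import Order.TTheory GRing.Theory Num.Theory.
Local Open Scope ring_scope.

Section KNN.
Variables (R : realFieldType) (N K C : nat) (y : 'I_N -> 'I_C) (yt : 'I_C).

Definition ind (j : 'I_N) : R := if y j == yt then 1 else 0.

Definition knn_util (S : {set 'I_N}) : R :=
  if S == set0 then (C%:R)^-1
  else ((minn K #|S|)%:R)^-1 *
       \sum_(j <- take (minn K #|S|) (sort (fun u v : 'I_N => (u <= v)%N) (enum S)))
          ind j.

(* Shapley value of i (paper's sum over k = 1..N is over k' = k-1 < N) *)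
Definition shapley (i : 'I_N) : R :=
  (N%:R)^-1 * \sum_(k < N) (('C(N.-1, k))%:R)^-1 *
     \sum_(S : {set 'I_N} | (i \notin S) && (#|S| == k))
        (knn_util (i |: S) - knn_util S).

(* a_i for the paper's 1-based index i (0 outside 1..N, never used there) *)
Definition a_nat (i : nat) : R :=
  match @insub nat (fun n => (n < N)%N) 'I_N i.-1 with
  | Some j => ind j
  | None => 0
  end.

Variable Kstar : nat.

Definition phihat_base : R := (N%:R)^-1 * (2^-1 - (C%:R)^-1).

Definition coef (i : nat) : R :=
  \sum_(1 <= j < K.+1) (j%:R)^-1 +
  (K%:R)^-1 * ((minn i K)%:R * (N.-1)%:R / i%:R - K%:R).

(* phihat_rec m = phihat at paper index Kstar - m *)
Fixpoint phihat_rec (m : nat) : R :=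
  match m with
  | 0 => phihat_base
  | m'.+1 => let i := (Kstar - m'.+1)%N in
      phihat_rec m' + (a_nat i - a_nat i.+1) / (N.-1)%:R * coef i
  end.

(* phihat at paper index i (1 <= i <= N) *)
Definition phihat (i : nat) : R :=
  if (Kstar <= i)%N then phihat_base else phihat_rec (Kstar - i).

End KNN.

(* Main.v *)
(* The Shapley value is a sum over S of marginals divided by C(M, |S|). Since
   1/C(M+1, k) + 1/C(M+1, k+1) = (M+2)/(M+1) * 1/C(M, k), any index that the
   summand ignores can be dropped at the price of a scalar. This gives both the
   formula for phi_i - phi_j over coalitions avoiding i and j, and the closed
   form of the sum over S of [fewer than K elements of S precede i] /
   min(K, |S|+1), which is the bracket of the recursion. Hence the recursion is
   exact and the error at i is the error at max(i, K^* ). There every nonempty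
   coalition has a marginal bounded by that same summand, while the empty one
   contributes a_i - 1/C, at distance 1/2 from 1/2 - 1/C. *)
Require Import Defs.
From mathcomp Require Import all_boot all_order all_algebra.
From mathcomp Require Import zify ring lra.
Import Order.TTheory GRing.Theory Num.Theory.
Local Open Scope ring_scope.

(** * Sums over subsets weighted by inverse binomial coefficients *)

Lemma invr_bin_addS (R : realFieldType) (M k : nat) : (k <= M)%N ->
  ('C(M.+1, k)%:R)^-1 + ('C(M.+1, k.+1)%:R)^-1
  = M.+2%:R / M.+1%:R * ('C(M, k)%:R)^-1 :> R.
Proof.
move=> le_kM.
have e1 : M.+1%:R * 'C(M, k)%:R = (M.+1%:R - k%:R) * 'C(M.+1, k)%:R :> R.
  by rewrite -natrB ?leqW // -!natrM mul_bin_down.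
have e2 : M.+1%:R * 'C(M, k)%:R = k.+1%:R * 'C(M.+1, k.+1)%:R :> R.
  by rewrite -!natrM mul_bin_diag.
have c0 : 'C(M, k)%:R != 0 :> R by rewrite pnatr_eq0 -lt0n bin_gt0.
have c1 : 'C(M.+1, k)%:R != 0 :> R by rewrite pnatr_eq0 -lt0n bin_gt0 leqW.
have c2 : 'C(M.+1, k.+1)%:R != 0 :> R by rewrite pnatr_eq0 -lt0n bin_gt0.
have m0 : M.+1%:R != 0 :> R by rewrite pnatr_eq0.
have -> : ('C(M.+1, k)%:R)^-1 = (M.+1%:R - k%:R) / (M.+1%:R * 'C(M, k)%:R) :> R.
  apply: (mulIf c1); rewrite mulVf // mulrAC -e1 divff // mulf_neq0 //.
have -> : ('C(M.+1, k.+1)%:R)^-1 = k.+1%:R / (M.+1%:R * 'C(M, k)%:R) :> R.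
  apply: (mulIf c2); rewrite mulVf // mulrAC -e2 divff // mulf_neq0 //.
rewrite -mulrDl invfM mulrA; congr (_ / _ / _).
by rewrite -!natr1; ring.
Qed.

Section WeightedSubsetSums.
Variables (R : realFieldType) (I : finType).
Implicit Types (S T A : {set I}) (F : {set I} -> R) (x : I).

Lemma sum_subset_D1 T x F : x \in T ->
  \sum_(S : {set I} | S \subset T) F S
  = \sum_(S : {set I} | S \subset T :\ x) (F S + F (x |: S)).
Proof.
move=> xT; rewrite (bigID (fun S : {set I} => x \in S)) /= addrC big_split /=.
congr (_ + _); first by apply: eq_bigl => S; rewrite subsetD1.
rewrite (reindex_onto (fun S => x |: S) (fun S => S :\ x)) /=; last first.
  by move=> S /andP[_ xS]; rewrite setD1K.
apply: eq_bigl => S; rewrite subUset sub1set xT setU11 andbT subsetD1.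
case: (boolP (x \in S)) => xS; last by rewrite setU1K ?eqxx ?andbT.
rewrite andbF; apply/negbTE; rewrite negb_and; apply/orP; right.
by apply: contraL xS => /eqP <-; rewrite !inE eqxx.
Qed.

(** There are ['C(#|T|, k)] subsets of [T] of size [k], so the weights within each size add up to
    1. *)
Lemma wsum_card T (f : nat -> R) :
  \sum_(S : {set I} | S \subset T) f #|S| / 'C(#|T|, #|S|)%:R
  = \sum_(k < #|T|.+1) f k.
Proof.
rewrite (partition_big (fun S : {set I} => inord #|S| : 'I_#|T|.+1) predT) //=.
apply: eq_bigr => k _.
rewrite (eq_bigl (fun S : {set I} => (S \subset T) && (#|S| == k))); last first.
  move=> S; case: (boolP (S \subset T)) => //= /subset_leq_card leS.
  by rewrite -val_eqE /= inordK // ltnS.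
rewrite (eq_bigr (fun=> f k / 'C(#|T|, k)%:R)); last by move=> S /andP[_ /eqP ->].
rewrite sumr_const.
have -> : #|[pred S : {set I} | (S \subset T) && (#|S| == k)]| = 'C(#|T|, k).
  by rewrite -cards_draws; apply: eq_card => S; rewrite !inE.
rewrite -[LHS]mulr_natr divfK // pnatr_eq0 -lt0n bin_gt0 -ltnS; exact: ltn_ord.
Qed.

(** Induction on [#|T :\: A|]: a point [x] of [T] outside [A] does not affect the summand, so
    pairing [S] with [x |: S] merges the two weights by [invr_bin_addS]. The factors
    [(#|T| + 1) / #|T|] telescope down to the case [T = A], which is [wsum_card]. *)
Lemma wsum_card_setI T A (f : nat -> R) : A \subset T ->
  \sum_(S : {set I} | S \subset T) f #|S :&: A| / 'C(#|T|, #|S|)%:R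
  = #|T|.+1%:R / #|A|.+1%:R * \sum_(k < #|A|.+1) f k.
Proof.
move: {2}#|T :\: A| (erefl #|T :\: A|) => n.
elim: n T => [|n IHn] T cardTA AT.
  have -> : A = T by apply/eqP; rewrite eqEsubset AT -setD_eq0 -cards_eq0 cardTA.
  rewrite divff ?pnatr_eq0 // mul1r -wsum_card.
  by apply: eq_bigr => S /setIidPl ->.
have /card_gt0P [x] : (0 < #|T :\: A|)%N by rewrite cardTA.
rewrite inE => /andP[xA xT].
have ATx : A \subset T :\ x by rewrite subsetD1 AT.
have cT : #|T| = #|T :\ x|.+1 by rewrite (cardsD1 x) xT.
rewrite (sum_subset_D1 _ _ _ xT).
transitivity (#|T|.+1%:R / #|T|%:R *
   \sum_(S : {set I} | S \subset T :\ x) f #|S :&: A| / 'C(#|T :\ x|, #|S|)%:R).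
  rewrite big_distrr /=; apply: eq_bigr => S; rewrite subsetD1 => /andP[ST xS].
  have -> : (x |: S) :&: A = S :&: A.
    apply/setP=> z; rewrite !inE; case: eqP => //= ->.
    by rewrite (negbTE xA) !andbF.
  rewrite cardsU1 xS add1n cT -mulrDr invr_bin_addS; last first.
    by rewrite subset_leq_card // subsetD1 ST.
  by rewrite mulrCA.
rewrite IHn //; last first.
  rewrite setDDl setUC -setDDl; apply/eqP; rewrite -eqSS -cardTA.
  by rewrite [#|T :\: A|](cardsD1 x) !inE xA xT.
rewrite -cT !mulrA; congr (_ * _ * _).
by rewrite divfK // pnatr_eq0 cT.
Qed.

(** Write [1 / min(K, #|S| + 1)] as [1/K + h #|S|]. Where [h] can be nonzero, [#|S| < K] forces the
    indicator to be 1, so the [h] part depends on [#|S|] only and produces the harmonic sum; the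
    constant [1/K] part depends on [#|S :&: A|] only. *)
Lemma wsum_topK T A (K : nat) : A \subset T -> (0 < K)%N -> (K <= #|T|.+2)%N ->
  \sum_(S : {set I} | S \subset T)
     (#|S :&: A| < K)%:R / (minn K #|S|.+1)%:R / 'C(#|T|, #|S|)%:R
  = \sum_(1 <= j < K.+1) (j%:R)^-1
    + (K%:R)^-1 * ((minn #|A|.+1 K)%:R * #|T|.+1%:R / #|A|.+1%:R - K%:R) :> R.
Proof.
move=> AT K0 KT.
have Kn0 : K%:R != 0 :> R by rewrite pnatr_eq0 -lt0n.
pose h (k : nat) : R := if (k < K)%N then (k.+1%:R)^-1 - (K%:R)^-1 else 0.
transitivity (\sum_(S : {set I} | S \subset T)
   (h #|S| / 'C(#|T|, #|S|)%:R
    + (K%:R)^-1 * ((#|S :&: A| < K)%:R / 'C(#|T|, #|S|)%:R))).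
  apply: eq_bigr => S _; rewrite mulrA -mulrDl; congr (_ / _).
  rewrite /h; have [SK|SK] := ltnP #|S| K.
    have -> : (#|S :&: A| < K)%N.
      by apply: leq_ltn_trans SK; rewrite subset_leq_card // subsetIl.
    by rewrite (minn_idPr SK) mul1r mulr1 subrK.
  by rewrite (minn_idPl _) ?leqW // add0r mulrC.
rewrite big_split /= -big_distrr /= wsum_card.
rewrite (wsum_card_setI _ _ (fun k => (k < K)%:R)) //.
have -> : \sum_(k < #|A|.+1) (k < K)%:R = (minn #|A|.+1 K)%:R :> R.
  rewrite -natr_sum; congr (_%:R).
  rewrite -(big_mkord xpredT (fun k => (k < K : nat)%N)).
  elim: #|A|.+1 => [|m IHm]; first by rewrite big_geq // min0n.
  rewrite big_nat_recr //= IHm; case: ltnP; lia.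
have -> : \sum_(k < #|T|.+1) h k = \sum_(1 <= j < K.+1) (j%:R)^-1 - 1.
  have <- : \sum_(0 <= k < K) h k = \sum_(1 <= j < K.+1) (j%:R)^-1 - 1.
    rewrite big_add1 /= (eq_big_nat _ _ (F2 := fun k => (k.+1%:R)^-1 - (K%:R)^-1)).
      by rewrite sumrB sumr_const_nat subn0 -[X in _ - X = _]mulr_natr mulVf.
    by move=> k /andP[_ kK]; rewrite /h kK.
  rewrite -(big_mkord xpredT).
  (* [h] already vanishes at [K - 1], so the range [k <= #|T|] misses no nonzero term even when
     [K = #|T| + 2]; this happens for [K = N] once two indices are removed. *)
  have h0 k : (K <= k.+1)%N -> h k = 0.
    rewrite /h; case: ltnP => // kK Kk.
    have -> : K = k.+1 by lia.
    by rewrite subrr.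
  have [le1|lt1] := leqP K #|T|.+1.
    rewrite (big_cat_nat (n := K)) //= [X in _ + X]big1_seq ?addr0 // => k.
    by rewrite mem_index_iota => /andP[_ /andP[? ?]]; apply: h0; lia.
  have -> : K = #|T|.+2 by lia.
  by rewrite [RHS]big_nat_recr //= h0 ?addr0 //; lia.
by field; rewrite Kn0 andbT addrC natr1 pnatr_eq0.
Qed.


End WeightedSubsetSums.

(** * The utility in terms of ranks, and its marginals *)

Section Utility.
Variables (R : realFieldType) (N K C : nat) (y : 'I_N -> 'I_C) (yt : 'I_C).
Implicit Types (S : {set 'I_N}) (i j u : 'I_N).

Local Notation a := (@ind R N C y yt).
Local Notation v := (@knn_util R N K C y yt).
Local Notation phi := (@shapley R N K C y yt).

Definition below i : {set 'I_N} := [set u : 'I_N | (u < i)%N].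

(** Zero-based position in [S]; for [i] outside [S] it is the position that [i] would take on
    insertion. *)
Definition rank S i : nat := #|S :&: below i|.

Definition hits S : R := \sum_(j in S | (rank S j < K)%N) a j.

Lemma index_sorted_ord (s : seq 'I_N) i :
  path.sorted (fun u v : 'I_N => (u <= v)%N) s -> uniq s -> i \in s ->
  index i s = count (fun u : 'I_N => (u < i)%N) s.
Proof.
elim: s => //= x s IHs xs /andP[xNs us].
have ltr : transitive (fun u v : 'I_N => (u <= v)%N).
  by move=> ? ? ?; apply: leq_trans.
have /allP min_x := order_path_min ltr xs.
rewrite inE eq_sym; case: eqVneq => [<- _|xi /= is_].
  rewrite ltnn add0n; apply/esym/eqP; rewrite -leqn0 leqNgt -has_count.
  by apply/hasPn => u /min_x; rewrite -leqNgt.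
rewrite (IHs (path_sorted xs) us is_) ltn_neqAle min_x // andbT.
by rewrite -(inj_eq val_inj) in xi; rewrite xi.
Qed.

Lemma rank_lt_card S i : i \in S -> (rank S i < #|S|)%N.
Proof.
move=> iS; apply: proper_card; apply/properP; split; first exact: subsetIl.
by exists i => //; rewrite !inE ltnn andbF.
Qed.

Lemma rank_inj S : {in S &, injective (rank S)}.
Proof.
have lt_rank i j : i \in S -> (i < j)%N -> (rank S i < rank S j)%N.
  move=> iS ij; apply: proper_card; apply/properP; split.
    by apply: setIS; apply/subsetP => u; rewrite !inE => /ltn_trans; apply.
  by exists i; rewrite !inE ?ltnn ?andbF // iS.
move=> i j iS jS eq_ij; apply: val_inj.
by case: (ltngtP (val i) (val j)) => // /lt_rank => [/(_ iS)|/(_ jS)];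
  rewrite eq_ij ltnn.
Qed.

(** Trades sorting for counting: in the sorted enumeration the index of a point is its rank. Since
    ranks in [S] are below [#|S|], the cutoff [min(K, #|S|)] reduces to [K]. *)
Lemma knn_util_hits S : S != set0 -> v S = (minn K #|S|)%:R^-1 * hits S.
Proof.
move=> S0; rewrite /knn_util (negbTE S0); congr (_ * _).
set m := minn K #|S|; set s := path.sort _ _.
have us : uniq s by rewrite sort_uniq enum_uniq.
have ms : s =i S by move=> u; rewrite mem_sort mem_enum.
have ss : path.sorted (fun u v : 'I_N => (u <= v)%N) s.
  by apply: sort_sorted => ? ?; apply: leq_total.
have -> : take m s = [seq u <- s | u \in take m s].
  by apply/subseq_uniqP => //; apply: take_subseq.
rewrite big_filter big_seq_cond.
rewrite (perm_big _ (permEl (perm_sort _ _))) /= big_enum_cond /= /hits.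
apply: eq_big => // u; rewrite ms.
case: (boolP (u \in S)) => //= uS; rewrite in_take ?ms //.
rewrite index_sorted_ord ?ms // -size_filter.
have -> : size [seq w : 'I_N <- s | (w < u)%N] = rank S u.
  rewrite -(card_uniqP _) ?filter_uniq //; apply: eq_card => w.
  by rewrite mem_filter ms !inE andbC.
by rewrite leq_min rank_lt_card ?andbT.
Qed.

Lemma ind_ge0 i : 0 <= a i. Proof. by rewrite /ind; case: ifP. Qed.

Lemma ind_le1 i : a i <= 1. Proof. by rewrite /ind; case: ifP. Qed.

Lemma rank_setU1 S i u : i \notin S -> rank (i |: S) u = ((i < u) + rank S u)%N.
Proof.
move=> iS; rewrite /rank setIUl; case: ltnP => iu.
  have -> : [set i] :&: below u = [set i].
    by apply/setIidPl; rewrite sub1set inE.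
  by rewrite cardsU1 inE (negbTE iS).
have -> : [set i] :&: below u = set0; last by rewrite set0U.
apply/setP => w; rewrite !inE; case: eqP => //= ->.
by rewrite ltnNge iu.
Qed.

Lemma hits_setU1 S i : i \notin S ->
  hits (i |: S) = a i *+ (rank S i < K)%N
                  + \sum_(u in S | ((i < u) + rank S u < K)%N) a u.
Proof.
move=> iS; rewrite /hits big_mkcondr /= big_setU1 //= rank_setU1 // ltnn add0n.
rewrite -mulrb; congr (_ + _); rewrite -big_mkcondr; apply: eq_bigl => u.
by rewrite rank_setU1.
Qed.

(** No point of [S] lies between the neighbours [i] and [j], so both enter at the same rank and
    displace the same points; only their own labels can differ. *)
Lemma knn_util_swap S i j : j = i.+1 :> nat -> i \notin S -> j \notin S ->
  v (i |: S) - v (j |: S)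
  = (a i - a j) * ((rank S i < K)%N%:R / (minn K #|S|.+1)%:R).
Proof.
move=> ji iS jS.
have U0 u : u |: S != set0 by apply/set0Pn; exists u; rewrite setU11.
rewrite !knn_util_hits // !cardsU1 iS jS !add1n -mulrBr !hits_setU1 //.
have -> : rank S j = rank S i.
  apply: eq_card => u; rewrite !inE; case: (boolP (u \in S)) => //= uS.
  have : u != i by apply: contraNneq iS => <-.
  by rewrite -(inj_eq val_inj) /= ji; lia.
rewrite (eq_bigl (fun u : 'I_N => (u \in S) && ((j < u) + rank S u < K)%N)).
  by rewrite -(mulr_natr (a i)) -(mulr_natr (a j)); ring.
move=> u; case: (boolP (u \in S)) => //= uS.
have : u != j by apply: contraNneq jS => <-.
by rewrite -(inj_eq val_inj) /= ji => ?; congr (nat_of_bool _ + _ < _)%N; lia.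
Qed.


(** If [#|S| < K], the utility is a plain average and moves by [a i] minus the old mean, divided by
    [#|S| + 1]. Otherwise either [i] misses the top [K] and nothing changes, or [i] takes the place
    of one point and the change is a difference of two labels over [K]. Both numerators are
    differences of numbers in [[0, 1]]. *)
Lemma knn_util_marginal S i : (0 < K)%N -> i \notin S -> S != set0 ->
  `|v (i |: S) - v S| <= (rank S i < K)%N%:R / (minn K #|S|.+1)%:R.
Proof.
move=> K0 iS S0.
have k0 : (0 < #|S|)%N by rewrite card_gt0.
have iS0 : i |: S != set0 by apply/set0Pn; exists i; rewrite setU11.
rewrite !knn_util_hits // hits_setU1 // cardsU1 iS add1n.
have leK u : u \in S -> (#|S| <= K)%N -> (rank S u < K)%N.
  by move=> uS; apply: leq_trans; apply: rank_lt_card.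
have [SK|KS] := ltnP #|S| K.
  have riK : (rank S i < K)%N.
    by apply: leq_ltn_trans SK; rewrite subset_leq_card // subsetIl.
  rewrite riK !mulr1n (minn_idPr SK).
  have -> : \sum_(u in S | ((i < u) + rank S u < K)%N) a u = \sum_(u in S) a u.
    apply: eq_bigl => u; case: (boolP (u \in S)) => //= uS.
    have ru := rank_lt_card S u uS; case: (i < u)%N => /=.
      exact: leq_ltn_trans ru SK.
    exact: ltn_trans ru SK.
  have -> : hits S = \sum_(u in S) a u.
    apply: eq_bigl => u; case: (boolP (u \in S)) => //= uS.
    by rewrite leK // ltnW.
  set s := \sum_(u in S) a u.
  have s0 : 0 <= s by apply: sumr_ge0 => u _; apply: ind_ge0.
  have s1 : s <= #|S|%:R.
    by rewrite -sumr_const; apply: ler_sum => u _; apply: ind_le1.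
  have kR : 0 < #|S|%:R :> R by rewrite ltr0n.
  have -> : #|S|.+1%:R^-1 * (a i + s) - #|S|%:R^-1 * s
            = (a i - s / #|S|%:R) / #|S|.+1%:R.
    by rewrite -natr1; field; rewrite natr1 pnatr_eq0 (gt_eqF kR).
  rewrite normrM [X in _ * X]ger0_norm ?invr_ge0 //.
  apply: ler_wpM2r; first by rewrite invr_ge0.
  have t0 : 0 <= s / #|S|%:R by rewrite divr_ge0.
  have t1 : s / #|S|%:R <= 1 by rewrite ler_pdivrMr // mul1r.
  by have := ind_ge0 i; have := ind_le1 i; rewrite ler_norml; lra.
rewrite (minn_idPl (leqW KS)) -mulrBr.
rewrite normrM ger0_norm ?invr_ge0 // mulrC.
apply: ler_wpM2r; first by rewrite invr_ge0.
have [riK|Kri] := ltnP (rank S i) K; last first.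
  rewrite mulr0n add0r /hits (eq_bigl (fun u : 'I_N => (u \in S) && (rank S u < K)%N)).
    by rewrite subrr normr0.
  move=> u; case: (boolP (u \in S)) => //= uS; case: (ltnP i u) => // iu.
  have riu : (rank S i <= rank S u)%N.
    apply: subset_leq_card; apply: setIS; apply/subsetP => w; rewrite !inE.
    by move=> /ltn_trans; apply.
  by lia.
rewrite !mulr1n /hits.
rewrite [X in _ - X](bigID (fun u : 'I_N => ((i < u) + rank S u < K)%N)) /=.
rewrite (eq_bigl (fun u : 'I_N => (u \in S) && (rank S u < K)%N
                                && ((i < u) + rank S u < K)%N)); last first.
  by move=> u; case: (u \in S) => //=; lia.
set s := \sum_(u | _) a u; set t := \sum_(u | _) a u.
(* Adding [i] pushes out of the top [K] at most the point of rank [K - 1]. *)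
have t0 : 0 <= t by apply: sumr_ge0 => u _; apply: ind_ge0.
have t1 : t <= 1.
  rewrite /t; set P := BIG_P.
  have Prank u : P u -> u \in S /\ rank S u = K.-1.
    by rewrite /P => /andP[/andP[-> ?] ?]; split => //; lia.
  have [u Pu|P0] := pickP P; last by rewrite big_pred0.
  rewrite (big_pred1 u) ?ind_le1 // => w; apply/idP/eqP => [Pw|->//].
  have [[wS rw] [uS ru]] := (Prank _ Pw, Prank _ Pu).
  by apply: (rank_inj S) => //; rewrite rw ru.
by have := ind_ge0 i; have := ind_le1 i; rewrite ler_norml; lra.
Qed.

(** * Shapley values: differences and distance to the base value *)

Lemma shapley_wsum i :
  phi i = (N%:R)^-1 * \sum_(S : {set 'I_N} | S \subset [set~ i])
                        (v (i |: S) - v S) / 'C(N.-1, #|S|)%:R.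
Proof.
rewrite /shapley; congr (_ * _); have N0 : (0 < N)%N by case: N i => [[]|].
have SN S : i \notin S -> (#|S| < N)%N.
  move=> iS; rewrite -[ltnRHS]card_ord -cardsT; apply: proper_card.
  by apply/properP; split=> //; exists i.
(* The default of [insubd] is never reached: by [SN], coalitions avoiding [i] have fewer than [N]
   elements. *)
rewrite [RHS](partition_big (fun S => insubd (Ordinal N0) #|S|) predT) //=.
apply: eq_bigr => k _; rewrite big_distrr /=; apply: eq_big => S.
  rewrite subsetC sub1set inE; case: (boolP (i \in S)) => //= iS.
  by rewrite -val_eqE val_insubd SN.
by move=> /andP[_ /eqP ->]; rewrite mulrC.
Qed.

(** Split each sum by membership of the other index. The terms in [v S] and in [v] of [S] with both
    indices cancel, and [v (i |: S) - v (j |: S)] keeps two consecutive inverse binomials, which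
    [invr_bin_addS] merges into one; its factor turns [1/N] into [1/(N-1)]. *)
Lemma shapley_sub i j : i != j ->
  phi i - phi j = (N.-1%:R)^-1 *
    \sum_(S : {set 'I_N} | S \subset [set~ i] :\ j)
      (v (i |: S) - v (j |: S)) / 'C(N.-2, #|S|)%:R.
Proof.
move=> ij; rewrite !shapley_wsum -mulrBr.
(* Two distinct indices force [N >= 2], which makes the truncated predecessors exact. *)
have cN : (N.-2.+2 = N)%N.
  have := leq_trans (subset_leq_card (subsetT [set i; j])) (eq_leq (cardsT _)).
  by rewrite cards2 ij card_ord; case: N => [|[|]].
rewrite (sum_subset_D1 _ _ [set~ i] j); last by rewrite !inE eq_sym.
rewrite (sum_subset_D1 _ _ [set~ j] i); last by rewrite !inE.
have -> : [set~ j] :\ i = [set~ i] :\ j.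
  by apply/setP => u; rewrite !inE andbC.
rewrite -sumrB !big_distrr /=; apply: eq_bigr => S.
rewrite !subsetD1 subsetC sub1set inE => /andP[iS jS].
have le_S : (#|S| <= N.-2)%N.
  have : S \subset ~: [set i; j].
    by rewrite subsetC subUset !sub1set !inE iS jS.
  move=> /subset_leq_card; rewrite [X in (_ <= X)%N]cardsCs setCK cards2 ij card_ord.
  by rewrite -[in X in (_ <= X)%N]cN /=; lia.
have := invr_bin_addS R _ _ le_S.
rewrite cN -[in N.-1%:R]cN -[in N.-1]cN /= setUCA !cardsU1 iS jS !add1n.
have N0 : N%:R != 0 :> R by rewrite -cN pnatr_eq0.
move=> e.
transitivity (N%:R^-1 * (v (i |: S) - v (j |: S))
   * ('C(N.-2.+1, #|S|)%:R^-1 + 'C(N.-2.+1, #|S|.+1)%:R^-1)); first by ring.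
by rewrite e; field; rewrite N0 addrC natr1 !pnatr_eq0 /= andbT -lt0n bin_gt0.
Qed.


Lemma card_below i : #|below i| = i.
Proof.
have le_iN : (i <= N)%N by apply/ltnW/ltn_ord.
have inj_w : injective (widen_ord le_iN).
  by move=> u w /(congr1 val) /= /val_inj.
rewrite -[RHS]card_ord -(card_imset _ inj_w).
apply: eq_card => u; rewrite inE.
apply/idP/imsetP => [ui|[w _ ->]]; last exact: (ltn_ord w).
by exists (Ordinal ui) => //; apply: val_inj.
Qed.

(** The recursion holds exactly for the true values: [knn_util_swap] makes the summand of
    [shapley_sub] the one evaluated by [wsum_topK], with [A] the points before [i]. The argument of
    [coef] is the one-based index of [i]. *)
Lemma shapley_succ i j : j = i.+1 :> nat -> (0 < K)%N -> (K <= N)%N ->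
  phi i - phi j = (a i - a j) / (N.-1)%:R * coef R N K i.+1.
Proof.
move=> ji K0 KN.
have ij : i != j by rewrite -(inj_eq val_inj) /= ji; lia.
have cT : #|[set~ i] :\ j| = N.-2.
  rewrite setDE -setCU cardsCs setCK cards2 ij card_ord; lia.
have lt_jN := ltn_ord j.
have e : (N.-2.+1 = N.-1)%N by lia.
rewrite shapley_sub // [_ / _]mulrC -mulrA; congr (_ * _).
have AT : below i \subset [set~ i] :\ j.
  apply/subsetP => u; rewrite !inE -!(inj_eq val_inj) /= ji; lia.
have := wsum_topK R _ _ _ _ AT K0; rewrite cT card_below e /coef => <-; last by lia.
rewrite big_distrr /=; apply: eq_bigr => S.
rewrite !subsetD1 subsetC sub1set inE => /andP[iS jS].
by rewrite (knn_util_swap S i j) // -!mulrA.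
Qed.

(** With [H] the [K]-th harmonic number, [wsum_topK] bounds the total over nonempty coalitions by
    [H - 2 + N / max(i + 1, K)]. The empty coalition adds [1/2], and [H - 3/2] is at most the sum in
    the bound. *)
Lemma shapley_near_base i : (0 < K)%N -> (K <= N)%N ->
  `|phihat_base R N C - phi i|
  <= (N%:R)^-1 * \sum_(2 <= j < K) (j.+1%:R)^-1 + ((maxn i.+1 K)%:R)^-1.
Proof.
move=> K0 KN.
have NR : 0 < N%:R :> R by rewrite ltr0n (leq_trans K0).
have KR : 0 < K%:R :> R by rewrite ltr0n.
have iR : 0 < i.+1%:R :> R by rewrite ltr0n.
have cT : #|[set~ i]| = N.-1 by rewrite cardsC1 card_ord.
have AT : below i \subset [set~ i].
  by apply/subsetP => u; rewrite !inE -!(inj_eq val_inj) /=; lia.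
have := wsum_topK R _ _ _ _ AT K0.
rewrite cT card_below (_ : N.-1.+1 = N); last by lia.
move=> /(_ ltac:(lia)).
rewrite shapley_wsum /phihat_base -mulrBr normrM ger0_norm ?invr_ge0 ?ler0n //.
(* The empty coalition is split off on both sides: it counts for 1 in the closed form and for
   [a i - 1/C] in the Shapley sum. The remainders over nonempty coalitions are [r] and [s]. *)
rewrite (bigD1 set0) ?sub0set //= [in X in _ -> X](bigD1 set0) ?sub0set //=.
rewrite set0I cards0 K0 (minn_idPr K0) bin0 !divr1 setU0.
set r := (X in 1 + X = _); set s := (X in _ - (_ + X)) => eG.
have le_sr : `|s| <= r.
  apply: le_trans (ler_norm_sum _ _ _) _; apply: ler_sum => S /andP[].
  rewrite subsetC sub1set inE => iS S0.
  rewrite normrM [X in _ * X]ger0_norm ?invr_ge0 ?ler0n //.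
  by apply: ler_wpM2r; rewrite ?invr_ge0 ?ler0n // knn_util_marginal.
have v0 : v set0 = C%:R^-1 by rewrite /knn_util eqxx.
have v1 : v [set i] = a i.
  have i0 : [set i] != set0 by apply/set0Pn; exists i; rewrite set11.
  rewrite knn_util_hits // -[in hits _](setU0 [set i]) hits_setU1 ?inE //.
  rewrite big_pred0; last by move=> u; rewrite inE.
  by rewrite /rank set0I cards0 K0 cards1 (minn_idPr K0) invr1 mul1r addr0.
rewrite v0 v1.
have le1 : `|2^-1 - C%:R^-1 - (a i - C%:R^-1 + s)| <= 2^-1 + r.
  (* The [1/C] terms cancel, and [1/2 - a i] has absolute value [1/2] for either value of [a i]. *)
  have /ler_normlP[] := le_sr; rewrite ler_norml /ind.
  by case: ifP => _; lra.
apply: (le_trans (ler_wpM2l _ le1)); first by rewrite invr_ge0 ltW.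
(* The product of the minimum and the maximum of two numbers is the product of the numbers. *)
have -> : (maxn i.+1 K)%:R^-1
          = N%:R^-1 * (K%:R^-1 * ((minn i.+1 K)%:R * N%:R / i.+1%:R)) :> R.
  case: (leqP i.+1 K) => _; field; rewrite !gt_eqF //=; lra.
rewrite -mulrDr; apply: ler_wpM2l; first by rewrite invr_ge0 ltW.
suff le2 : \sum_(1 <= j < K.+1) (j%:R)^-1 - 2^-1 - 1
           <= \sum_(2 <= j < K) (j.+1%:R)^-1 :> R.
  move: eG le2; rewrite mulrBr mulVf ?gt_eqF //.
  move: (\sum_(2 <= j < K) _ : R) (\sum_(1 <= j < K.+1) _ : R).
  by move: (K%:R^-1 * _ : R) (r : R) => ? ? ? ? ? ?; lra.
(* For [K = 1] the left side is [-1/2] against an empty sum; for [K >= 2] removing the terms [1] and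
   [1/2] gives equality after a shift of index. *)
case: K K0 => [//|[_|k _]]; first by rewrite big_nat1 big_geq // invr1; lra.
have -> : \sum_(2 <= j < k.+2) (j.+1%:R)^-1 = \sum_(3 <= j < k.+3) (j%:R)^-1 :> R.
  by rewrite [RHS]big_add1.
by rewrite big_ltn // big_ltn // invr1; lra.
Qed.

End Utility.

(** * The error bound, transported along the recursion *)

Theorem theorem3 (R : realFieldType) (N K C Kstar : nat)
    (y : 'I_N -> 'I_C) (yt : 'I_C) :
  (1 <= C)%N -> (1 <= K)%N -> (maxn 2 K <= N)%N ->
  (1 <= Kstar)%N -> (Kstar < N)%N ->
  forall i : 'I_N,
    `| @phihat R N K C y yt Kstar i.+1 - @shapley R N K C y yt i |
      <= (N%:R)^-1 * \sum_(2 <= j < K) ((j.+1)%:R)^-1 + ((maxn Kstar K)%:R)^-1.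
Proof.
move=> _ K0; rewrite geq_max => /andP[_ KN] Ks0 KsN i.
have a_natS (u : 'I_N) : a_nat R y yt u.+1 = ind R y yt u.
  by rewrite /a_nat /= valK.
have bound (u : 'I_N) : (Kstar <= u.+1)%N ->
  `|phihat_base R N C - shapley R K y yt u|
  <= (N%:R)^-1 * \sum_(2 <= j < K) (j.+1%:R)^-1 + ((maxn Kstar K)%:R)^-1.
  move=> Ku; apply: le_trans (shapley_near_base R N K C y yt u K0 KN) _.
  rewrite lerD2l lef_pV2 ?posrE ?ltr0n ?leq_max ?K0 ?orbT // ler_nat.
  by rewrite geq_max !leq_max Ku leqnn orbT.
rewrite /phihat; case: leqP => [/bound //|iK].
have KsN' : (Kstar.-1 < N)%N by lia.
(* [s] is the one-based index [Kstar], where the recursion starts; exactness makes the error at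
   every earlier index equal to the error at [s]. *)
pose s := Ordinal KsN'.
suff -> : phihat_rec R K y yt Kstar (Kstar - i.+1) - shapley R K y yt i
        = phihat_base R N C - shapley R K y yt s.
  by apply: bound; rewrite /=; lia.
move: {-1}(Kstar - i.+1)%N (erefl (Kstar - i.+1)%N) => m.
elim: m i iK => [|m IHm] i iK em; first by lia.
have jN : (i.+1 < N)%N by lia.
pose j := Ordinal jN.
rewrite /= -em subKn; last by lia.
have succ := shapley_succ R N K C y yt i j erefl K0 KN.
rewrite (a_natS i) (a_natS j).
have -> : shapley R K y yt i = shapley R K y yt j
   + (ind R y yt i - ind R y yt j) / N.-1%:R * coef R N K i.+1.
  by rewrite -succ addrC subrK.
rewrite opprD addrACA subrr addr0.
(* With a single recursion step left, [j] is [s] and the recursion is at its base value; otherwise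
   [j] is still before [Kstar] and the induction hypothesis applies. *)
case: m IHm em => [|m] IHm em; last by apply: IHm => //=; lia.
by rewrite /=; congr (_ - shapley _ _ _ _ _); apply: val_inj => /=; lia.
Qed.
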